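(* Let $\Gamma$ be a free group of finite rank $n\geq 2$ and let $H<\Gamma$ be a subgroup of finite rank and infinite index. There exists a basis $\{x_1,\dots,x_n\}$ of $\Gamma$ (as a free group) such that for all $g\in\Gamma$ and for all $i\in\{1,\dots,n\}$ we have $$gHg^{-1}\cap\langle x_i\rangle=\{1\},$$ which is to say that no conjugate of $H$ contains a (non-trivial) power of an element of this basis.
   Context: $\langle x_i\rangle$ denotes the cyclic subgroup of $\Gamma$ generated by $x_i$. *)

(* Defs.v *)
From mathcomp Require Import all_boot.
From mathcomp Require Import boolp classical_sets functions cardinality.

Set Implicit Arguments.
Unset Strict Implicit.
Unset Printing Implicit Defensive.

Local Open Scope classical_set_scope.
Local Open Scope group_scope.

(* Universal property. A multiplicative map between groups is a group
   morphism. *)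
Definition is_free_basis (G : groupType) (n : nat) (x : 'I_n -> G) : Prop :=
  forall (K : groupType) (f : 'I_n -> K),
    exists phi : {multiplicative G -> K},
      (forall i, phi (x i) = f i) /\
      (forall psi : {multiplicative G -> K},
         (forall i, psi (x i) = f i) -> psi =1 phi).

Definition is_free_group_of_rank (G : groupType) (n : nat) : Prop :=
  exists x : 'I_n -> G, is_free_basis x.

Definition is_subgroup (G : groupType) (H : set G) : Prop :=
  [/\ H 1,
      forall a b, H a -> H b -> H (a * b)
    & forall a, H a -> H a^-1].

Definition subgroup_generated (G : groupType) (A : set G) : set G :=
  smallest (@is_subgroup G) A.

Definition cyclic_subgroup (G : groupType) (x : G) : set G :=
  subgroup_generated [set x].

(* The rank of a group is the least cardinality of a generating set (for a free
   group, this is the cardinality of its bases). *)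
Definition has_finite_rank (G : groupType) (H : set G) : Prop :=
  exists A : set G, finite_set A /\ subgroup_generated A = H.

Definition left_coset (G : groupType) (H : set G) (g : G) : set G :=
  [set g * h | h in H].

Definition has_infinite_index (G : groupType) (H : set G) : Prop :=
  infinite_set (range (left_coset H)).

(* g H g^-1; MathComp's [h ^ g] is g^-1 * h * g. *)
Definition conj_subgroup (G : groupType) (g : G) (H : set G) : set G :=
  [set g * h * g^-1 | h in H].

(* Main.v *)
(* An element b has a power conjugate into H exactly when b has a finite orbit
   on the coset space H\Gamma. As H is finitely generated, for a basis x every
   Schreier-graph loop with cyclically reduced label stays in a finite core.
   Hence the points with finite x_j-orbit form a finite set F(x_j), and by the
   pigeonhole principle F(x_i x_j^N) is contained in F(x_j) for N large. Choose
   x and j with F(x_j) of least cardinality: then F(x_i x_j^N) = F(x_j) for all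
   i <> j, so F(x_j) is a finite Gamma-invariant set, and it is empty because H
   has infinite index. The basis x_j, x_i x_j^N (i <> j) is as required. *)
From HB Require Import structures.
Require Import Defs.
From mathcomp Require Import all_boot.
From mathcomp Require Import boolp classical_sets functions cardinality.
From mathcomp Require Import zify.

Set Implicit Arguments.
Unset Strict Implicit.
Unset Printing Implicit Defensive.

Local Open Scope classical_set_scope.
Local Open Scope group_scope.

(** * Reduced words and the concrete free group *)

Section ReducedWords.
Variable T : choiceType.
Implicit Types (a : T * bool) (u v w : seq (T * bool)).

(* The letter (i, true) stands for the generator i, (i, false) for its
   inverse. *)
Definition flip a := (a.1, ~~ a.2).

Definition reduced w := sorted (fun a b => b != flip a) w.

Definition push a w :=
  if w is b :: t then if b == flip a then t else a :: w else [:: a].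

(* [mulw u v] is the reduced form of [u ++ v] as soon as [v] is reduced. *)
Definition mulw u v := foldr push v u.

Definition invw w := rev (map flip w).

Lemma flipK : involutive flip.
Proof. by case=> i b; rewrite /flip /= negbK. Qed.

Lemma reduced_behead a w : reduced (a :: w) -> reduced w.
Proof. exact: path_sorted. Qed.

Lemma push_id a w : reduced (a :: w) -> push a w = a :: w.
Proof. by case: w => [|b w] //= /andP[/negPf ->]. Qed.

Lemma push_reduced a w : reduced w -> reduced (push a w).
Proof.
case: w => [|b w] //= wr; case: ifPn => [_|ba]; first exact: path_sorted wr.
by rewrite /= ba.
Qed.

Lemma pushK a w : reduced w -> push (flip a) (push a w) = w.
Proof.
case: w => [|b w] wr /=; first by rewrite flipK eqxx.
case: eqP => [<-|_]; first exact: push_id.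
by rewrite /= flipK eqxx.
Qed.

Lemma mulw_reduced u v : reduced v -> reduced (mulw u v).
Proof. by move=> vr; elim: u => //= a u; apply: push_reduced. Qed.

(** If [push] cancels the head of [u], that letter and [a] also undo each other on reduced words, by
    [pushK]. Associativity rests on this. *)
Lemma mulw_push a u v : reduced v -> mulw (push a u) v = push a (mulw u v).
Proof.
move=> vr; case: u => [|b u] //=; case: eqP => [->|//].
by rewrite -{1}(flipK a) pushK //; apply: mulw_reduced.
Qed.

Lemma mulwA u v w : reduced w -> mulw u (mulw v w) = mulw (mulw u v) w.
Proof. by move=> wr; elim: u => //= a u IH; rewrite mulw_push // IH. Qed.

Lemma mulw0 w : reduced w -> mulw w [::] = w.
Proof.
elim: w => //= a w IH wr; rewrite IH; last exact: path_sorted wr.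
exact: push_id.
Qed.

Lemma invw_reduced w : reduced w -> reduced (invw w).
Proof.
rewrite /reduced /invw rev_sorted sorted_map; apply: sub_sorted => a b /=.
by rewrite flipK eq_sym.
Qed.

Lemma invwK : involutive invw.
Proof. by move=> w; rewrite /invw map_rev revK mapK //; apply: flipK. Qed.

Lemma mulVKw w v : reduced v -> mulw (invw w) (mulw w v) = v.
Proof.
move=> vr; elim: w => //= a w IH.
rewrite /invw /= rev_cons /mulw foldr_rcons pushK ?IH //.
exact: mulw_reduced.
Qed.

Lemma mulVw w : reduced w -> mulw (invw w) w = [::].
Proof. by move=> wr; rewrite -{2}(mulw0 wr) mulVKw. Qed.

Lemma mulwV w : reduced w -> mulw w (invw w) = [::].
Proof. by move=> wr; rewrite -{1}(invwK w) mulVw ?invw_reduced. Qed.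

Lemma size_invw w : size (invw w) = size w.
Proof. by rewrite size_rev size_map. Qed.

Lemma invw_cat u v : invw (u ++ v) = invw v ++ invw u.
Proof. by rewrite /invw map_cat rev_cat. Qed.

Lemma invw_mulw u v : reduced u -> reduced v ->
  invw (mulw u v) = mulw (invw v) (invw u).
Proof.
move=> ur vr.
have mr := mulw_reduced u vr.
rewrite -[RHS](mulw0 _); last exact/mulw_reduced/invw_reduced.
rewrite -(mulwV mr) mulwA ?invw_reduced // -[mulw (mulw (invw v) _) _]mulwA //.
by rewrite mulVKw // mulVw.
Qed.

(** Each letter of [u] cancels at most one letter, so [v2] is never reached; the length bound
    carries the induction. *)
Lemma mulw_catr u v1 v2 : size u <= size v1 ->
  mulw u (v1 ++ v2) = mulw u v1 ++ v2 /\ size v1 - size u <= size (mulw u v1).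
Proof.
elim: u => [|a u IH] /=; first by rewrite subn0.
move=> ltu; have [-> les] := IH (ltnW ltu).
case: (mulw u v1) les => [|b t] /= les; first by lia.
by case: ifP => _ /=; split=> //; lia.
Qed.

(** The cut between [v1] and [v2] survives reduction, so [mulw u v1] is a prefix of the reduced
    product. *)
Lemma mulw_middle u v1 v2 u' : reduced u -> reduced u' -> reduced (v1 ++ v2) ->
  size u <= size v1 -> size u' <= size v2 ->
  mulw (mulw u (v1 ++ v2)) u' = mulw u v1 ++ mulw v2 u'.
Proof.
move=> ur ur' vr lu lu'.
have [v1r v2r] : reduced v1 /\ reduced v2.
  by have [] := cat_sorted2 vr.
have [E _] := mulw_catr v2 lu.
have wr : reduced (mulw u v1 ++ v2) by rewrite -E; apply: mulw_reduced.
(* Inversion turns the cancellation on the right into one on the left. *)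
rewrite E; apply: (can_inj invwK).
rewrite invw_mulw // !invw_cat (invw_mulw v2r ur').
have [|-> //] := @mulw_catr (invw u') (invw v2) (invw (mulw u v1)).
by rewrite !size_invw.
Qed.

Record free_group := FreeGroup { word : seq (T * bool); _ : reduced word }.

HB.instance Definition _ := [isSub for word].
HB.instance Definition _ := [Choice of free_group by <:].

Lemma word_reduced (g : free_group) : reduced (word g).
Proof. by case: g. Qed.

Definition fg_one := @FreeGroup [::] isT.
Definition fg_inv g := FreeGroup (invw_reduced (word_reduced g)).
Definition fg_mul g h :=
  FreeGroup (mulw_reduced (word g) (word_reduced h)).

Lemma fg_mulA : associative fg_mul.
Proof. by move=> g h k; apply: val_inj; apply/mulwA/word_reduced. Qed.

Lemma fg_1mul : left_id fg_one fg_mul.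
Proof. by move=> g; apply: val_inj. Qed.

Lemma fg_mul1 : right_id fg_one fg_mul.
Proof. by move=> g; apply/val_inj/mulw0/word_reduced. Qed.

Lemma fg_Vmul : left_inverse fg_one fg_inv fg_mul.
Proof. by move=> g; apply/val_inj/mulVw/word_reduced. Qed.

Lemma fg_mulV : right_inverse fg_one fg_inv fg_mul.
Proof. by move=> g; apply/val_inj/mulwV/word_reduced. Qed.

HB.instance Definition _ :=
  isGroup.Build free_group fg_mulA fg_1mul fg_mul1 fg_Vmul fg_mulV.

(** * Evaluation of words in a group *)

Section Evaluation.
Variables (G : groupType) (x : T -> G).

Definition eval_letter a := if a.2 then x a.1 else (x a.1)^-1.

Definition eval w := foldr (fun a g => eval_letter a * g) 1 w.

Lemma eval_flip a : eval_letter (flip a) = (eval_letter a)^-1.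
Proof. by case: a => i [] //=; rewrite /eval_letter /= invgK. Qed.

Lemma eval_cat u v : eval (u ++ v) = eval u * eval v.
Proof. by elim: u => /= [|a u ->]; rewrite ?mul1g ?mulgA. Qed.

Lemma eval_push a w : eval (push a w) = eval_letter a * eval w.
Proof.
case: w => [|b w] //=; case: eqP => [->|//].
by rewrite eval_flip mulVKg.
Qed.

Lemma eval_mulw u v : eval (mulw u v) = eval u * eval v.
Proof. by elim: u => /= [|a u IH]; rewrite ?mul1g // eval_push IH mulgA. Qed.

Lemma eval_invw w : eval (invw w) = (eval w)^-1.
Proof.
elim: w => /= [|a w IH]; first by rewrite invg1.
by rewrite /invw /= rev_cons -cats1 eval_cat IH /= mulg1 eval_flip invgM.
Qed.

(** Reduction only removes backtracking, so it adds no vertex to the Cayley-graph path of [u]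
    followed by [v]. [Q] is arbitrary so that the induction can translate it by a letter. *)
Lemma eval_prefix_mulw (Q : G -> Prop) u v :
  (forall k, Q (eval (take k u))) -> (forall k, Q (eval u * eval (take k v))) ->
  forall k, Q (eval (take k (mulw u v))).
Proof.
elim: u Q => /= [|a u IH] Q Qu Qv k.
  by have := Qv k; rewrite mul1g.
have Q0 : Q 1 := Qu 0%N.
have QS j : Q (eval_letter a * eval (take j (mulw u v))).
  apply: (IH (fun g => Q (eval_letter a * g))) => [i|i].
    exact: (Qu i.+1).
  by rewrite mulgA.
case: (mulw u v) QS => [|b t] QS /=.
  by case: k => [|[|k]] //; apply: (QS 0%N).
case: eqP => [ba|_].
  by have := QS k.+1; rewrite /= ba eval_flip mulVKg.
by case: k => [|k] //; apply: (QS k).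
Qed.

End Evaluation.
End ReducedWords.

(** * Normal forms over a free basis *)

Section GroupMultiplicative.
Variables (G K : groupType) (phi : {multiplicative G -> K}).

Lemma multiplicative1 : phi 1 = 1.
Proof. by apply: (mulgI (phi 1)); rewrite -gmulfM !mulg1. Qed.

Lemma multiplicativeV : {morph phi : g / g^-1}.
Proof.
by move=> g; apply/esym/mulg1_eq; rewrite -gmulfM mulgV multiplicative1.
Qed.

Lemma multiplicativeX k : {morph phi : g / g ^+ k}.
Proof.
by move=> g; elim: k => [|k IH]; rewrite ?multiplicative1 // !expgS gmulfM IH.
Qed.

End GroupMultiplicative.

Definition eval_word (T : choiceType) (G : groupType) (x : T -> G)
  (g : free_group T) := eval x (word g).

HB.instance Definition _ (T : choiceType) (G : groupType) (x : T -> G) :=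
  isMultiplicative.Build (free_group T) G (eval_word x)
    (fun g h => eval_mulw x (word g) (word h)).

(** The universal property maps [G] to the group of reduced words; its uniqueness clause, for maps
    from [G] to itself, makes evaluation a left inverse of this map. *)
Lemma free_basis_normal_form (n : nat) (G : groupType) (x : 'I_n -> G) :
  is_free_basis x ->
  exists nf : G -> seq ('I_n * bool),
    [/\ forall g, reduced (nf g), cancel nf (eval x),
        forall w, reduced w -> nf (eval x w) = w
      & {morph nf : g h / g * h >-> mulw g h}].
Proof.
move=> xB.
have [phi [phix _]] := xB _ (fun i => @FreeGroup _ [:: (i, true)] isT).
have [psi [_ psiU]] := xB _ x.
have evphi : cancel phi (eval_word x).
  move=> g; transitivity (psi g).
    apply: (psiU (eval_word x \o phi)) => i.
    by rewrite /= phix /eval_word /= /eval_letter mulg1.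
  by rewrite -(psiU idfun).
exists (fun g => word (phi g)); split=> [g|g|w wr|g h].
- exact: word_reduced.
- exact: evphi.
- elim: w wr => /= [|a w IH] wr; first by rewrite multiplicative1.
  rewrite gmulfM /= IH; last exact: reduced_behead wr.
  case: a wr => i [] wr; rewrite /eval_letter /= ?multiplicativeV phix /=;
    exact: push_id.
- by rewrite gmulfM.
Qed.

(** Loops with positive labels can be repeated and concatenated without any cancellation. *)
Definition positive_word (T : Type) (v : seq T) := [seq (i, true) | i <- v].

Lemma positive_word_reduced (T : choiceType) (v : seq T) :
  reduced (positive_word v).
Proof.
case: v => //= i v; elim: v i => //= j v IH i.
by rewrite IH andbT xpair_eqE andbF.
Qed.

(** * Finite orbits on cosets and the finite core *)

Section FiniteOrbits.
Variables (G : groupType) (H : set G).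
Hypothesis H_subgroup : is_subgroup H.

(* Points of H\Gamma are represented by elements [g] of their coset H g. *)
Definition in_cosets (r : seq G) (g : G) := exists2 t, t \in r & H (g * t^-1).

(** A positive power of [b] fixes the coset H g; the successor excludes exponent 0. *)
Definition finite_orbit (b g : G) := exists k, H (g * b ^+ k.+1 * g^-1).

Lemma in_cosetsMl r h g : H h -> in_cosets r g -> in_cosets r (h * g).
Proof.
case: H_subgroup => _ HM _ Hh [t tr Ht]; exists t => //.
by rewrite -mulgA; apply: HM.
Qed.

Lemma finite_orbit_coset b g g' :
  H (g * g'^-1) -> finite_orbit b g' -> finite_orbit b g.
Proof.
case: H_subgroup => _ HM HV Hgg [k Hk]; exists k.
have := HM _ _ (HM _ _ Hgg Hk) (HV _ Hgg).
by rewrite invgM invgK !mulgA !mulgVK.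
Qed.

Lemma finite_orbitMr b g : finite_orbit b (g * b) <-> finite_orbit b g.
Proof.
have E k : g * b * b ^+ k.+1 * (g * b)^-1 = g * b ^+ k.+1 * g^-1.
  by rewrite -(mulgA g b) -expgS expgSr invgM !mulgA mulgK.
by split=> -[k Hk]; exists k; rewrite ?E // -E.
Qed.

Lemma finite_orbit_exp b g k m :
  H (g * b ^+ k * g^-1) -> H (g * b ^+ (k * m) * g^-1).
Proof.
case: H_subgroup => H1 HM _ Hk; elim: m => [|m IH].
  by rewrite muln0 expg0 mulg1 mulgV.
have := HM _ _ Hk IH.
by rewrite !mulgA mulgVK -(mulgA g) -expgnDr -mulnS.
Qed.

(** The list [r] collects the vertices on the generator loops. The elements of [H] whose paths stay
    in these cosets form a subgroup containing the generators. *)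
Lemma generated_prefixes n (x : 'I_n -> G) (nf : G -> seq ('I_n * bool)) :
  (forall g, reduced (nf g)) -> cancel nf (eval x) ->
  (forall w, reduced w -> nf (eval x w) = w) ->
  {morph nf : g h / g * h >-> mulw g h} ->
  has_finite_rank H ->
  exists r : seq G,
    forall h k, H h -> in_cosets r (eval x (take k (nf h))).
Proof.
move=> nfr nfK nfE nfM [A [/finite_seqP[s As] AH]].
have [H1 HM HV] := H_subgroup.
pose pref a := [seq eval x (take k (nf a)) | k <- iota 0 (size (nf a)).+1].
pose r := 1 :: flatten [seq pref a | a <- s].
exists r.
pose P := [set h | H h /\ forall k, in_cosets r (eval x (take k (nf h)))].
suff HP : H `<=` P by move=> h k /HP[_]; apply.
rewrite -[X in X `<=` _]AH; apply: smallest_sub.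
- split.
  + split=> // k; rewrite (nfE [::] isT : nf 1 = [::]).
    by exists 1; rewrite ?mem_head // mul1g invg1.
  + move=> g h [Hg Pg] [Hh Ph]; split=> [|k]; first exact: HM.
    rewrite nfM; apply: eval_prefix_mulw => // j.
    by rewrite nfK; apply: in_cosetsMl.
  + move=> g [Hg Pg]; split=> [|k]; first exact: HV.
    have -> : nf g^-1 = invw (nf g).
      by rewrite -{1}(nfK g) -eval_invw nfE //; apply: invw_reduced.
    rewrite /invw take_rev -map_drop -/(invw _) eval_invw size_map.
    set m := (size _ - k)%N.
    (* The inverse loop runs backwards through the same vertices, up to the factor [g^-1] in [H]. *)
    have -> : (eval x (drop m (nf g)))^-1 = g^-1 * eval x (take m (nf g)).
      rewrite -{2}(nfK g) -{2}(cat_take_drop m (nf g)) eval_cat invgM.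
      by rewrite mulgVK.
    by apply: in_cosetsMl; first exact: HV.
- move=> a; rewrite As /= => sa; split=> [|k].
    rewrite -AH; apply: sub_gen_smallest; rewrite As; exact: sa.
  exists (eval x (take k (nf a))); last by rewrite mulgV.
  rewrite in_cons; apply/orP; right; apply/flattenP.
  exists (pref a); first exact: map_f.
  apply/mapP; exists (minn k (size (nf a))).
    by rewrite mem_iota ltnS geq_minr.
  have [lek|ltk] := leqP k (size (nf a)); first by [].
  by rewrite take_size take_oversize // ltnW.
Qed.

Section FreeBasis.
Variables (n : nat) (x : 'I_n -> G).
Hypothesis x_basis : is_free_basis x.

Lemma free_basis_generates g : exists w, eval x w = g.
Proof.
have [nf [_ nfK _ _]] := free_basis_normal_form x_basis.
by exists (nf g); apply: nfK.
Qed.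

(** Once both halves are longer than the normal forms of [g] and [g'], cancellation misses the cut,
    which is then a vertex on the path of an element of [H]. Only [L] depends on [g] and [g']. *)
Lemma positive_prefix_in_cosets : has_finite_rank H ->
  exists r : seq G, forall g g' : G, exists L : nat,
    forall v1 v2 : seq 'I_n, L <= size v1 -> L <= size v2 ->
      H (g * eval x (positive_word (v1 ++ v2)) * g') ->
      in_cosets r (g * eval x (positive_word v1)).
Proof.
have [nf [nfr nfK nfE nfM]] := free_basis_normal_form x_basis.
move=> /(generated_prefixes nfr nfK nfE nfM)[r rP]; exists r => g g'.
exists (maxn (size (nf g)) (size (nf g'))) => v1 v2 + +.
rewrite !geq_max => /andP[l1 _] /andP[_ l2] /= /rP.
move=> /(_ (size (mulw (nf g) (positive_word v1)))).
rewrite !nfM nfE ?positive_word_reduced // /positive_word map_cat.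
rewrite mulw_middle ?size_map ?nfr -?map_cat ?positive_word_reduced //.
by rewrite take_size_cat // eval_mulw nfK.
Qed.

Lemma eval_nseq i k : eval x (positive_word (nseq k i)) = x i ^+ k.
Proof. by elim: k => //= k ->; rewrite expgS. Qed.

Lemma eval_flatten_nseq w k :
  eval x (positive_word (flatten (nseq k w))) =
  eval x (positive_word w) ^+ k.
Proof.
by elim: k => //= k IH; rewrite /positive_word map_cat eval_cat IH expgS.
Qed.

(** The loop at [g] is repeated [2 * L] times and cut in the middle, where the path is back in the
    coset of [g]. *)
Lemma finite_orbit_in_cosets : has_finite_rank H ->
  exists r, forall j g, finite_orbit (x j) g -> in_cosets r g.
Proof.
case: (H_subgroup) => _ HM HV.
move=> /positive_prefix_in_cosets[r rP]; exists r => j g [k Hk].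
have [L LP] := rP g g^-1.
have HL := finite_orbit_exp L Hk.
have := LP (nseq (k.+1 * L) j) (nseq (k.+1 * L) j).
rewrite !size_nseq /= !leq_pmull // /positive_word map_cat eval_cat.
rewrite !eval_nseq -expgnDr.
rewrite addnn -mul2n [(2 * _)%N]mulnC => /(_ isT isT (finite_orbit_exp 2 HL)).
move=> /(in_cosetsMl (HV _ HL)).
by rewrite !invgM invgK !mulgA mulgVK mulgVK.
Qed.

(* A loop labelled by a large power of [x i * x j ^+ N] runs through [N.+1]
   consecutive vertices of an [x j]-orbit, all of them in the [size r = N]
   cosets of the core; two of them coincide. *)
Lemma finite_orbit_twist : has_finite_rank H ->
  exists N, forall i j g, finite_orbit (x i * x j ^+ N) g ->
    finite_orbit (x j) g.
Proof.
case: (H_subgroup) => _ HM HV.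
move=> /positive_prefix_in_cosets[r rP]; exists (size r) => i j.
set N := size r; set w := x i * x j ^+ N.
(* Finiteness of the [w]-orbit passes to its predecessor, so the target may be taken at the end of
   an edge path labelled [w]. *)
suff main g : finite_orbit w g -> finite_orbit (x j) (g * w).
  move=> g Fg; rewrite -(mulgVK w g); apply: main.
  by apply/finite_orbitMr; rewrite mulgVK.
move=> [k Hk].
have [L LP] := rP g g^-1.
pose ww := i :: nseq N j.
have eww : eval x (positive_word ww) = w by rewrite /= eval_nseq.
have sww M : (M <= size (flatten (nseq M ww)))%N.
  by elim: M => //= M IH; rewrite size_cat ltnS (leq_trans IH) // leq_addl.
pose M := (k.+1 * L)%N.
have HM1 := finite_orbit_exp L Hk.
(* The outer blocks of [M] copies of [w] give the length [L] on each side; the vertices of interest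
   lie on the first [w] of the middle block. *)
have HM2 : H (g * w ^+ (M + k.+1 + M) * g^-1).
  have -> : (M + k.+1 + M = k.+1 * (L + 1 + L))%N by rewrite /M; lia.
  exact: finite_orbit_exp.
have vis t : (t <= N)%N -> in_cosets r (g * x i * x j ^+ t).
  move=> tN.
  have := LP (flatten (nseq M ww) ++ i :: nseq t j)
             (nseq (N - t) j ++ flatten (nseq (k + M) ww)).
  rewrite !size_cat.
  have leM : (L <= M)%N by rewrite leq_pmull.
  have l1 : (L <= size (flatten (nseq M ww)) + size (i :: nseq t j))%N.
    by rewrite (leq_trans leM) // (leq_trans (sww M)) // leq_addr.
  have l2 : (L <= size (nseq (N - t) j) + size (flatten (nseq (k + M) ww)))%N.
    rewrite (leq_trans leM) // (leq_trans (leq_addl k M)) //.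
    by rewrite (leq_trans (sww _)) // leq_addl.
  rewrite l1 l2 /= => /(_ isT isT).
  rewrite /positive_word !map_cat !eval_cat !eval_flatten_nseq eww /=.
  rewrite !eval_nseq /eval_letter /=.
  have -> : w ^+ M * (x i * x j ^+ t) * (x j ^+ (N - t) * w ^+ (k + M)) =
            w ^+ (M + k.+1 + M).
    rewrite -!mulgA (mulgA (x j ^+ t)) -expgnDr subnKC // (mulgA (x i)) -/w.
    by rewrite -expgS -expgnDr -addnA.
  move=> /(_ HM2) /(in_cosetsMl (HV _ HM1)).
  by rewrite !invgM invgK !mulgA mulgVK mulgVK.
have [t tr Ht] : exists2 t : 'I_N.+1 -> G,
    forall s, t s \in r & forall s : 'I_N.+1, H (g * x i * x j ^+ s * (t s)^-1).
  have /choice[t tP] : forall s : 'I_N.+1, exists t,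
      t \in r /\ H (g * x i * x j ^+ s * t^-1).
    by move=> s; have [t] := vis s (ltn_ord s); exists t.
  by exists t => s; case: (tP s).
have [s [s' [lts ets]]] : exists s s' : 'I_N.+1, (s < s')%N /\ t s = t s'.
  have tN (s : 'I_N.+1) : (index (t s) r < N)%N by rewrite index_mem tr.
  have /injectivePn[s [s' nss [ets]]] :
      ~~ injectiveb (fun s => Ordinal (tN s)).
    by apply/negP => /injectiveP /leq_card; rewrite !card_ord ltnn.
  have {}ets : t s = t s' by rewrite -(nth_index 1 (tr s)) ets nth_index.
  move: nss; rewrite neq_ltn => /orP[lts|lts]; first by exists s, s'.
  by exists s', s.
(* Equal cosets at times [s < s'] make [x j ^+ (s' - s)] fix the coset of [g * x i]; the predecessor
   offsets the successor in [finite_orbit]. *)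
have Fgi : finite_orbit (x j) (g * x i).
  exists (s' - s).-1; rewrite prednK ?subn_gt0 // expgnFr ?(ltnW lts) //.
  have := HM _ _ (Ht s') (HV _ (Ht s)).
  by rewrite ets !invgM invgK !mulgA mulgVK.
rewrite /w mulgA.
have F m : finite_orbit (x j) (g * x i * x j ^+ m).
  elim: m => [|m IH]; first by rewrite mulg1.
  by rewrite expgSr mulgA; apply/finite_orbitMr.
exact: F.
Qed.

End FreeBasis.
End FiniteOrbits.

(** * Twisted bases and finite index *)

Definition twist (G : groupType) (n : nat) (x : 'I_n -> G) (j : 'I_n) (N : nat)
  (i : 'I_n) : G := if i == j then x j else x i * x j ^+ N.

Lemma twist_free_basis (G : groupType) (n : nat) (x : 'I_n -> G) j N :
  is_free_basis x -> is_free_basis (twist x j N).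
Proof.
move=> xB K f.
(* Values on [x] forced by the values [f] on the twisted family. *)
pose f' i := if i == j then f j else f i * f j ^- N.
have [phi [phix phiU]] := xB K f'.
have phij : phi (x j) = f j by rewrite phix /f' eqxx.
exists phi; split=> [i|psi psix].
  rewrite /twist; case: eqP => [->//|/eqP /negPf ij].
  by rewrite gmulfM multiplicativeX phij phix /f' ij mulgVK.
apply: phiU => i.
have psij : psi (x j) = f j by have := psix j; rewrite /twist eqxx.
rewrite /f'; case: eqP => [->//|/eqP /negPf ij].
have := psix i; rewrite /twist ij gmulfM multiplicativeX psij => <-.
by rewrite mulgK.
Qed.

(** Inversion exchanges the right coset H t with the left coset t^-1 H. *)
Lemma finite_index_of_cosets (G : groupType) (H : set G) (r : seq G) :
  is_subgroup H -> (forall g, in_cosets H r g) -> ~ has_infinite_index H.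
Proof.
move=> [_ HM HV] rP; apply.
apply: sub_finite_set (finite_seq [seq left_coset H t^-1 | t <- r]).
move=> _ [g _ <-] /=.
have [t tr Ht] := rP g^-1.
apply/mapP; exists t => //; apply/seteqP; split=> _ [h Hh <-].
  exists (t * g * h); last by rewrite !mulgA mulVg mul1g.
  by apply: HM => //; rewrite -(invgK (t * g)) invgM; apply: HV.
exists (g^-1 * t^-1 * h); last by rewrite !mulgA mulgV mul1g.
exact: HM.
Qed.

(** * Descent to a basis element without finite orbits *)

Section InfiniteIndex.
Variables (n : nat) (G : groupType) (H : set G).
Hypotheses (H_subgroup : is_subgroup H) (H_finite_rank : has_finite_rank H).
Hypothesis H_infinite_index : has_infinite_index H.

(** Invariance under a basis is invariance under the whole group, so one point of [S] would put
    every element in the finitely many cosets of [r]. *)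
Lemma invariant_core_empty (x : 'I_n -> G) (S : set G) r :
  is_free_basis x -> (forall g, S g -> in_cosets H r g) ->
  (forall i g, S (g * x i) <-> S g) -> forall g, ~ S g.
Proof.
move=> xB Sr Sx g Sg.
apply: (finite_index_of_cosets H_subgroup _ H_infinite_index) => k.
apply: Sr; have [w Ew] := free_basis_generates xB (g^-1 * k).
suff main g' : S (g' * eval x w) <-> S g'.
  by rewrite -(mulVKg g k) -Ew; apply/main.
elim: w g' {Ew} => [|[i b] w IH] g' /=; first by rewrite mulg1.
rewrite mulgA; apply: (iff_trans (IH _)); case: b; first exact: Sx.
by apply: (iff_trans (iff_sym (Sx i _))); rewrite mulgVK.
Qed.

(** Induction on a bound for [r] replaces the minimal choice: either all [y i] have the same
    finite-orbit points as [x j], an invariant set, or some [y i] misses a coset of [r]. *)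
Lemma exists_basis_element_no_finite_orbit m (x : 'I_n -> G) j r :
  is_free_basis x -> size r <= m ->
  (forall g, finite_orbit H (x j) g -> in_cosets H r g) ->
  exists y : 'I_n -> G, exists j,
    is_free_basis y /\ forall g, ~ finite_orbit H (y j) g.
Proof.
elim: m x j r => [|m IH] x j r xB.
  rewrite leqn0 size_eq0 => /eqP -> xr; exists x, j; split=> // g /xr[t].
  by rewrite in_nil.
move=> rm xr.
have [N twistN] := finite_orbit_twist H_subgroup xB H_finite_rank.
pose y := twist x j N; have yB : is_free_basis y := twist_free_basis j N xB.
have yx i g : finite_orbit H (y i) g -> finite_orbit H (x j) g.
  by rewrite /y /twist; case: eqP => // _; apply: twistN.
have [allr|/existsNP[i /existsNP[t /not_implyP[tr nFt]]]] :=
    pselect (forall i t, t \in r -> finite_orbit H (y i) t).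
  exists x, j; split=> //; apply: (invariant_core_empty yB xr) => i g.
  have xy k : finite_orbit H (x j) k <-> finite_orbit H (y i) k.
    split; last exact: yx.
    move=> /xr[t tr Ht].
    exact: (finite_orbit_coset H_subgroup Ht (allr i t tr)).
  by rewrite !xy; apply: finite_orbitMr.
apply: (IH y i [seq s <- r | s != t]) => //.
  rewrite -ltnS; apply: leq_trans rm.
  rewrite size_filter -(count_predC (pred1 t) r) -addn1 addnC leq_add2r.
  by rewrite -has_count has_pred1.
move=> g Fg; have [s sr Hs] := xr g (yx _ _ Fg).
exists s => //; rewrite mem_filter sr andbT; apply/eqP => st.
apply: nFt; rewrite -st; apply: (finite_orbit_coset H_subgroup _ Fg).
have [_ _ HV] := H_subgroup.
by have := HV _ Hs; rewrite invgM invgK.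
Qed.

End InfiniteIndex.

(** * Cyclic subgroups and the conclusion *)

Lemma cyclic_subgroup_exp (G : groupType) (b g : G) : cyclic_subgroup b g ->
  exists p q, g = b ^+ p * b ^- q.
Proof.
suff sub : cyclic_subgroup b `<=` [set g | exists p q, g = b ^+ p * b ^- q].
  exact: sub.
apply: smallest_sub; last first.
  by move=> _ ->; exists 1%N, 0%N; rewrite expg1 expg0 invg1 mulg1.
split=> [|_ _ [p [q ->]] [p' [q' ->]]|_ [p [q ->]]].
- by exists 0%N, 0%N; rewrite expg0 invg1 mulg1.
- exists (p + p')%N, (q + q')%N; rewrite expgnDr [(q + q')%N]addnC.
  rewrite expgnDr invgM !mulgA; congr (_ * _); rewrite -!mulgA; congr (_ * _).
  by apply/esym/commuteV/commute_sym/commuteX2.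
- by exists q, p; rewrite invgM invgK.
Qed.

(** If [p] and [q] differ, the element or its inverse is a positive power of [b] fixing the coset of
    [g^-1]. *)
Lemma cyclic_subgroup_meet (G : groupType) (H : set G) (b g z : G) :
  is_subgroup H -> (forall k, ~ finite_orbit H b k) ->
  conj_subgroup g H z -> cyclic_subgroup b z -> z = 1.
Proof.
move=> [_ _ HV] Fb [h Hh <-{z}] /cyclic_subgroup_exp[p [q E]].
have Hpq : H (g^-1 * (b ^+ p * b ^- q) * g^-1^-1).
  by rewrite -E invgK !mulgA mulVg mul1g mulgVK.
rewrite E; case: (ltngtP p q) => [lt|lt|->]; last by rewrite mulgV.
- case: (Fb g^-1); exists (q - p).-1; rewrite prednK ?subn_gt0 //.
  by rewrite expgnFr 1?ltnW //; have := HV _ Hpq; rewrite !invgM !invgK !mulgA.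
- case: (Fb g^-1); exists (p - q).-1; rewrite prednK ?subn_gt0 //.
  by rewrite expgnFr 1?ltnW.
Qed.

Theorem lemma1p2 (n : nat) (Gamma : groupType) (H : set Gamma)
    (n_ge2 : (2 <= n)%N)
    (Gamma_free : is_free_group_of_rank Gamma n)
    (H_subgroup : is_subgroup H)
    (H_finite_rank : has_finite_rank H)
    (H_infinite_index : has_infinite_index H) :
  exists x : 'I_n -> Gamma,
    is_free_basis x /\
    forall (g : Gamma) (i : 'I_n),
      conj_subgroup g H `&` cyclic_subgroup (x i) = [set 1].
Proof.
have [x0 x0B] := Gamma_free.
pose j0 : 'I_n := Ordinal (ltnW n_ge2).
have [r rP] := finite_orbit_in_cosets H_subgroup x0B H_finite_rank.
have [x [j [xB xj]]] := exists_basis_element_no_finite_orbit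
  H_subgroup H_finite_rank H_infinite_index x0B (leqnn (size r)) (rP j0).
(* Only [x j] is known to have no finite orbit; a last twist passes this on to every basis
   element. *)
have [N twistN] := finite_orbit_twist H_subgroup xB H_finite_rank.
exists (twist x j N); split=> [|g i]; first exact: twist_free_basis.
apply/seteqP; split=> [z [zg zi]|_ ->].
  apply: (cyclic_subgroup_meet H_subgroup _ zg zi) => k.
  by rewrite /twist; case: eqP => _ // /twistN; apply: xj.
split; last by move=> S [[]].
by case: (H_subgroup) => H1 _ _; exists 1; rewrite ?mulg1 ?mulgV.
Qed.
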